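(* There exists a constant $C$, independent of $n\in\mathbb{N}^+$, such that for all $n\in\mathbb{N}^+$ $$\left|\int_0^T\tau^{\alpha-1}E_{\alpha,\alpha}(-\lambda_n\tau^\alpha)h(T-\tau)\,d\tau\right|\le C\lambda_n^{-1}$$ and $$\left|\int_0^T\tau^{2\alpha-2}E_{\alpha,\alpha}(-\lambda_{N_0}\tau^\alpha)E_{\alpha,\alpha}(-\lambda_n\tau^\alpha)\,d\tau\right|\le C\lambda_n^{-1+\frac{1}{2\alpha}}.$$
   Context: Let $\alpha\in(1/2,1)$, $T>0$, and let $D\subset\mathbb{R}^n$ be open and bounded. Let $$\mathcal{A}u=-\sum_{i,j=1}^n a^{ij}(x)u_{x_ix_j}+\sum_{i=1}^n b^i(x)u_{x_i}+c(x)u,\qquad a^{ij},b^i,c\in C^\infty(\mathbb{R}^n),$$ be symmetric, elliptic and positive definite, considered with zero Dirichlet boundary condition on $\partial D$. Its eigensystem is $\{(\lambda_n,\phi_n):n\in\mathbb{N}^+\}$, where $0<\lambda_1\le\lambda_2\le\cdots$ and $\{\phi_n\}\subset H^2(D)\cap H^1_0(D)$ is an orthonormal basis of $L^2(D)$. The Mittag--Leffler function is $E_{\alpha,\beta}(z)=\sum_{k=0}^\infty \frac{z^k}{\Gamma(k\alpha+\beta)}$. The function $h\in L^\infty(0,T)$ is positive and bounded from below, i.e. $h\ge c_h$ for some $c_h>0$. A nonzero $g\in L^2(D)$ is given, and $N_0\in\mathbb{N}^+$ is a fixed index such that $\langle g,\phi_{N_0}\rangle_{L^2(D)}\neq0$.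 *)

(* Defs.v *)
From HB Require Import structures.
From mathcomp Require Import all_boot all_order all_algebra.
From mathcomp Require Import all_classical all_reals all_analysis.

Set Implicit Arguments.
Unset Strict Implicit.
Unset Printing Implicit Defensive.

Import Order.TTheory GRing.Theory Num.Theory.
Import numFieldNormedType.Exports.

Local Open Scope classical_set_scope.
Local Open Scope ring_scope.

(* The sigma-algebra on R^n is the one generated by the coordinates, which is *)
(* the Borel sigma-algebra.                                                   *)
Definition rV_display : measure_display.
Proof. exact: (measure_tuple_display default_measure_display). Qed.

Section rV_measurable.
Context (R : realType) (n : nat).

Let coord (i : 'I_n) (x : 'rV[R]_n) : measurableTypeR R := x ord0 i.

Let rV_set0 : g_sigma_preimage coord set0.
Proof. exact: sigma_algebra0. Qed.

Let rV_setC A : g_sigma_preimage coord A -> g_sigma_preimage coord (~` A).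
Proof. exact: sigma_algebraC. Qed.

Let rV_bigcup (F : (set 'rV[R]_n)^nat) :
  (forall i, g_sigma_preimage coord (F i)) ->
  g_sigma_preimage coord (\bigcup_i F i).
Proof. exact: sigma_algebra_bigcup. Qed.

HB.instance Definition _ := @isMeasurable.Build rV_display 'rV[R]_n
  (g_sigma_preimage coord) rV_set0 rV_setC rV_bigcup.

Lemma measurable_coord (i : 'I_n) :
  measurable_fun [set: 'rV[R]_n] (fun x : 'rV[R]_n => x ord0 i).
Proof.
move=> _ Y mY; rewrite setTI; apply: sub_sigma_algebra => /=.
rewrite -bigcup_seq/=; exists i => /=; first by rewrite mem_index_enum.
by exists Y => //; rewrite setTI.
Qed.

Lemma measurable_fun_rV d (T : measurableType d) (f : T -> 'rV[R]_n) :
  (forall i, measurable_fun setT (fun t => f t ord0 i)) ->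
  measurable_fun setT f.
Proof.
move=> mf _ A mA; rewrite setTI.
suff: g_sigma_preimage (fun i => coord i \o f) `<=` measurable.
  by apply; rewrite g_sigma_preimage_comp; exists A => //; rewrite setTI.
apply: smallest_sub; first exact: sigma_algebra_measurable.
rewrite -bigcup_seq => B [/= i _] [C mC <-]; exact: mf.
Qed.

End rV_measurable.

Section lebesgue_rV.
Context (R : realType).

Definition rV_cons n (p : 'rV[R]_n * R) : 'rV[R]_n.+1 :=
  row_mx (const_mx p.2 : 'rV_1) p.1.

Lemma measurable_rV_cons n :
  measurable_fun [set: 'rV[R]_n * measurableTypeR R] (@rV_cons n).
Proof.
apply: measurable_fun_rV => i; rewrite /rV_cons.
case: (splitP (i : 'I_(1 + n))) => j ij.
- rewrite (_ : (fun _ => _) = snd); first exact: measurable_snd.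
  apply/funext => p; rewrite (_ : i = lshift n j :> 'I_(1 + n)).
    by rewrite (@row_mxEl _ 1 1 n) mxE.
  exact: val_inj.
- rewrite (_ : (fun _ => _) = (fun x : 'rV[R]_n => x ord0 j) \o fst).
    by apply: measurableT_comp => //; exact: measurable_coord.
  apply/funext => p; rewrite (_ : i = rshift 1 j :> 'I_(1 + n)).
    by rewrite (@row_mxEr _ 1 1 n).
  exact: val_inj.
Qed.

Section lebesgue_rV_step.
Variables (n : nat) (m : {measure set 'rV[R]_n -> \bar R}).

Definition lebesgue_rV_step : set 'rV[R]_n.+1 -> \bar R :=
  pushforward (m \x (@lebesgue_measure R))%E (@rV_cons n).

Let mcons := @measurable_rV_cons n.

Let step0 : lebesgue_rV_step set0 = 0%E.
Proof. by rewrite /lebesgue_rV_step measure0. Qed.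

Let step_ge0 A : (0 <= lebesgue_rV_step A)%E.
Proof. exact: measure_ge0. Qed.

Let step_sigma_additive : semi_sigma_additive lebesgue_rV_step.
Proof. exact: measure_semi_sigma_additive. Qed.

HB.instance Definition _ := isMeasure.Build _ _ _ lebesgue_rV_step
  step0 step_ge0 step_sigma_additive.

End lebesgue_rV_step.

(* n-dimensional Lebesgue measure, as the n-fold product of lebesgue_measure. *)
Fixpoint lebesgue_rV n : {measure set 'rV[R]_n -> \bar R} :=
  if n is m.+1 then lebesgue_rV_step (lebesgue_rV m) else dirac (0 : 'rV[R]_0).

End lebesgue_rV.

Section smooth_functions.
Context (R : realType) (d : nat).
Implicit Type f : 'rV[R]_d.+1 -> R.

(* A multi-index is a list of coordinates; [:: i; j] stands for d_i d_j.      *)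
Definition partial (s : seq 'I_d.+1) f : 'rV[R]_d.+1 -> R :=
  foldr (fun i g => 'D_(delta_mx ord0 i) g) f s.

Definition smooth f : Prop :=
  forall s, continuous (partial s f) /\
    forall i x, derivable (partial s f) x (delta_mx ord0 i).

(* C_c^oo(D) *)
Definition test_fun (D : set 'rV[R]_d.+1) f : Prop :=
  [/\ smooth f, compact (closure [set x | f x != 0]) &
      closure [set x | f x != 0] `<=` D].

End smooth_functions.

Section sobolev.
Context (R : realType) (d : nat).
Variable D : set 'rV[R]_d.+1.
Implicit Types u v : 'rV[R]_d.+1 -> R.

Local Notation mu := (@lebesgue_rV R d.+1).

Definition L2 u : Prop :=
  measurable_fun D u /\ (\int[mu]_(x in D) ((u x) ^+ 2)%:E < +oo)%E.

Definition inner u v : R := \int[mu]_(x in D) (u x * v x).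

Definition ae_eq_on u v : Prop := {ae mu, forall x, D x -> u x = v x}.

Definition is_weak_partial (s : seq 'I_d.+1) u v : Prop :=
  forall f, test_fun D f -> inner u (partial s f) = (-1) ^+ size s * inner v f.

(* The weak derivative in L^2(D), determined up to a.e. equality on D when it *)
(* exists; the constant 0 otherwise.                                          *)
Definition weak_partial (s : seq 'I_d.+1) u : 'rV[R]_d.+1 -> R :=
  xget (cst 0) [set v | L2 v /\ is_weak_partial s u v].

(* H^k(D) *)
Definition sobolev_H (k : nat) u : Prop :=
  L2 u /\ forall s : seq 'I_d.+1, (size s <= k)%N ->
    exists v, L2 v /\ is_weak_partial s u v.

(* H^1_0(D): the closure of C_c^oo(D) in H^1(D) *)
Definition sobolev_H10 u : Prop :=
  sobolev_H 1 u /\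
  exists f : nat -> 'rV[R]_d.+1 -> R,
    [/\ forall k, test_fun D (f k),
        inner (u \- f k) (u \- f k) @[k --> \oo] --> (0 : R) &
        forall i, inner (weak_partial [:: i] u \- partial [:: i] (f k))
                        (weak_partial [:: i] u \- partial [:: i] (f k))
                    @[k --> \oo] --> (0 : R)].

Definition H2_H10 u : Prop := sobolev_H 2 u /\ sobolev_H10 u.

Definition orthonormal_basis (phi : nat -> 'rV[R]_d.+1 -> R) : Prop :=
  [/\ forall k, L2 (phi k),
      forall j k, inner (phi j) (phi k) = (j == k)%:R &
      forall u, L2 u ->
        let r m := fun x => u x - \sum_(k < m) inner u (phi k) * phi k x in
        inner (r m) (r m) @[m --> \oo] --> (0 : R)].

End sobolev.

Section elliptic_operator.
Context (R : realType) (d : nat).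
Variable D : set 'rV[R]_d.+1.
Variables (a : 'I_d.+1 -> 'I_d.+1 -> 'rV[R]_d.+1 -> R)
  (b : 'I_d.+1 -> 'rV[R]_d.+1 -> R) (c : 'rV[R]_d.+1 -> R).

Definition diff_op (u : 'rV[R]_d.+1 -> R) : 'rV[R]_d.+1 -> R := fun x =>
  - (\sum_i \sum_j a i j x * weak_partial D [:: i; j] u x)
  + \sum_i b i x * weak_partial D [:: i] u x + c x * u x.

Definition elliptic : Prop :=
  exists theta : R, 0 < theta /\
    forall x, D x -> forall xi : 'rV[R]_d.+1,
      theta * \sum_i (xi ord0 i) ^+ 2 <=
      \sum_i \sum_j a i j x * xi ord0 i * xi ord0 j.

(* The Dirichlet condition is carried by the domain, the intersection of      *)
(* H^2(D) and H^1_0(D).                                                       *)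
Definition symmetric_op : Prop :=
  forall u v, H2_H10 D u -> H2_H10 D v ->
    inner D (diff_op u) v = inner D u (diff_op v).

Definition positive_definite_op : Prop :=
  forall u, H2_H10 D u -> ~ ae_eq_on D u (cst 0) -> 0 < inner D (diff_op u) u.

(* lam k and phi k are the eigenvalue and eigenfunction of index k + 1.       *)
Definition dirichlet_eigensystem
    (lam : nat -> R) (phi : nat -> 'rV[R]_d.+1 -> R) : Prop :=
  [/\ 0 < lam 0%N,
      {homo lam : j k / (j <= k)%N >-> j <= k},
      forall k, H2_H10 D (phi k),
      forall k, ae_eq_on D (diff_op (phi k)) (fun x => lam k * phi k x) &
      orthonormal_basis D phi].

End elliptic_operator.

Section mittag_leffler.
Context (R : realType).

Definition Gamma (x : R) : R :=
  \int[lebesgue_measure]_(t in `]0, +oo[) (t `^ (x - 1) * expR (- t)).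

Definition mittag_leffler (alpha beta z : R) : R :=
  limn (series (fun k : nat => z ^+ k / Gamma (k%:R * alpha + beta))).

End mittag_leffler.

(* h \in L^oo(0, T) *)
Definition Linfty_interval (R : realType) (T : R) (h : R -> R) : Prop :=
  measurable_fun `]0, T[ h /\
  exists M : R, {ae lebesgue_measure, forall t, t \in `]0, T[ -> `|h t| <= M}.

(* Main.v *)
Require Import Defs.
From mathcomp Require Import all_boot all_order all_algebra.
From mathcomp Require Import all_classical all_reals all_analysis.
From mathcomp Require Import measurable_realfun ring lra.

Set Implicit Arguments.
Unset Strict Implicit.
Unset Printing Implicit Defensive.

Import Order.TTheory GRing.Theory Num.Theory.
Import numFieldNormedType.Exports.

Local Open Scope classical_set_scope.
Local Open Scope ring_scope.

(** Both bounds come from properties of [relax alpha L s], that is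
[E_{alpha,alpha}(- L s ^ alpha)], which hold for [0 < alpha < 1] with constants
independent of [L > 0]; they are applied at the eigenvalues [L = lam n].

Put [k s = s ^ (alpha - 1) / Gamma alpha] and [u s = s ^ (alpha - 1) * relax
alpha L s].  Integrating the power series of [u] against the kernel term by term
with Euler's Beta integral ([beta_integral]) shifts the series by one place, so
[u] is the resolvent of the kernel [k] ([volterra]):

  [L * \int_0^t k (t - s) u s ds = k t - u t].

Everything follows from this equation and two properties of the kernel.

- The kernel is log-convex, [k (t0 - s) / k (t - s) <= k t0 / k t] for
  [0 < s < t < t0], and this forces [u > 0] ([relax_gt0]).  Let [t0] be the first
  zero of [u] and let [t] be a maximum point of [u] on a short interval
  [[t0 - d, t0]].  Comparing the equation at [t0] with the equation at [t]
  ([volterra_step]), the past up to [t] contributes to [u t0] at least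
  [(k t0 / k t) u t >= u t / 2], whereas the convolution over [[t, t0]] takes
  away at most [u t] times a multiple of [d ^ alpha].  For small [d] the value
  [u t0] is then positive.
- The convolution is now nonnegative, so [u <= k], that is
  [relax alpha L t <= 1 / Gamma alpha] ([relax_le]).  The kernel is decreasing,
  so [k t * L * \int_0^t u <= k t - u t <= k t], that is
  [\int_0^t u <= 1 / L] ([integral_relax_le]).

The last inequality, together with the essential bound of [h], is the first
estimate.  For the second one, the factor of index [N0] is at most
[1 / Gamma alpha], and the integral of [s ^ (2 alpha - 2) * relax alpha L s] is
cut at [s = L ^ (- 1 / alpha)]: before the cut [relax] is bounded by
[1 / Gamma alpha], after it [s ^ (alpha - 1)] is bounded by its value at the cut
([integral_relax_sq_le]).  This gives [C * L ^ (-2 + 1 / alpha)], the square of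
the required power of [L], and one of the two factors is bounded because
[lam n >= lam 0]. *)

(** * Affine changes of variable for the Lebesgue integral *)

Section affine_change.
Context {R : realType}.
Local Notation mu := (@lebesgue_measure R).

Lemma measurable_affine (a b : R) : measurable_fun setT
  ((fun x => a * x + b) : measurableTypeR R -> measurableTypeR R).
Proof.
by apply: measurable_funD => //; apply: measurable_funM.
Qed.

Lemma preimage_affine_itv (a b x y : R) : 0 < a ->
  (fun s : R => a * s + b) @^-1` `]x, y] = `](x - b) / a, (y - b) / a]%classic.
Proof.
move=> a0; apply/seteqP; split => s /=; rewrite !in_itv/=.
  by move=> /andP[h1 h2]; rewrite ltr_pdivrMr// ler_pdivlMr//; apply/andP; split; lra.
by move=> /andP[]; rewrite ltr_pdivrMr// ler_pdivlMr// => h1 h2; apply/andP; split; lra.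
Qed.

Lemma lebesgue_measure_affine (a b : R) (A : set R) : 0 < a -> measurable A ->
  mu A = (a%:E * pushforward mu
    ((fun x => a * x + b)%R : measurableTypeR R -> measurableTypeR R) A)%E.
Proof.
move=> a0 mA.
pose pm := measure_function_pushforward__canonical__measure_function_Measure
  mu (measurable_affine a b).
rewrite -[RHS]/(mscale (NngNum (ltW a0)) pm A).
apply: lebesgue_measure_unique => // _ [[x y]] _ <-.
rewrite /= /mscale/= /pushforward preimage_affine_itv//.
rewrite !lebesgue_measure_itv/= !lte_fin.
rewrite ltr_pM2r ?invr_gt0// ltrD2r; case: ifPn => // _; last by rewrite mule0.
by rewrite -EFinD -EFinM; congr EFin; field; rewrite gt_eqF.
Qed.

Lemma ge0_integral_affine (a b : R) (f : R -> \bar R) : 0 < a ->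
  measurable_fun setT f -> (forall x, (0 <= f x)%E) ->
  (\int[mu]_x f x = a%:E * \int[mu]_x f (a * x + b)%R)%E.
Proof.
move=> a0 mf f0; have mphi := measurable_affine a b.
rewrite -(@ge0_integral_pushforward _ _ _ _ _ _ mphi mu setT f)//.
rewrite -[a%:E]/(((NngNum (ltW a0))%:num)%:E) -ge0_integral_mscale//.
by apply: eq_measure_integral => A mA _; exact: lebesgue_measure_affine.
Qed.

End affine_change.

(** * Euler's Gamma integral *)

Section powR_aux.
Context {R : realType}.
Local Notation mu := (@lebesgue_measure R).

Lemma continuous_powR (p x : R) : 0 < x -> {for x, continuous (@powR R ^~ p)}.
Proof.
move=> x0; apply: differentiable_continuous; apply/derivable1_diffP.
by apply: derivable_powR; rewrite in_itv/= x0.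
Qed.

Lemma measurable_powR_subr (p t : R) :
  measurable_fun setT (fun s : R => (t - s) `^ p).
Proof.
apply: (@measurableT_comp _ _ _ _ _ _ (@powR R ^~ p)); first exact: measurable_powR.
exact: measurable_funB.
Qed.

Lemma le_powR_npos (q x y : R) : q <= 0 -> 0 < x -> x <= y -> y `^ q <= x `^ q.
Proof.
move=> q0 x0 xy; have y0 := lt_le_trans x0 xy.
rewrite -[q]opprK !(powRN _ (- q)) lef_pV2 ?posrE ?powR_gt0//.
by rewrite ge0_ler_powR ?oppr_ge0 ?nnegrE ?(ltW x0) ?(ltW y0).
Qed.

(** Exponentials beat powers: [ln x < x] at [x = t / (2 q)]. *)
Lemma powR_le_expR (q t : R) : 0 < q -> 0 < t ->
  t `^ q <= (2 * q) `^ q * expR (t / 2).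
Proof.
move=> q0 t0.
have q20 : 0 < 2 * q by rewrite mulr_gt0.
rewrite -ler_pdivrMl ?powR_gt0// mulrC -powRN.
have -> : t `^ q * (2 * q) `^ (- q) = (t / (2 * q)) `^ q.
  have q21 : 0 <= (2 * q)^-1 by rewrite invr_ge0 ltW.
  by rewrite (powRM _ (ltW t0) q21) -(powR_inv1 (ltW q20)) -powRrM mulN1r.
rewrite -ler_ln ?posrE ?powR_gt0 ?divr_gt0 ?expR_gt0// ln_powR expRK.
rewrite (_ : t / 2 = q * (t / (2 * q))); last by field; rewrite gt_eqF.
by rewrite ler_pM2l// ltW// ln_sublinear// divr_gt0.
Qed.

Lemma integral_powR_segment (p a : R) : 0 < p -> 0 < a < 1 ->
  (\int[mu]_(t in `[a, 1%R]) (t `^ (p - 1))%:E = ((1 - a `^ p) / p)%:E)%E.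
Proof.
move=> p0 /andP[a0 a1].
have cF x : 0 < x -> {for x, continuous (fun t : R => p^-1 * t `^ p)}.
  by move=> x0; apply: continuousM; [exact: cst_continuous|exact: continuous_powR].
rewrite (@continuous_FTC2 _ _ (fun t : R => p^-1 * t `^ p) a 1 a1).
- by rewrite -EFinB powR1 mulr1; congr EFin; field; rewrite gt_eqF.
- apply: continuous_in_subspaceT => x; rewrite inE/= in_itv/= => /andP[ax _].
  by apply: continuous_powR; exact: lt_le_trans ax.
- split.
  + move=> x; rewrite in_itv/= => /andP[ax _].
    apply: derivableM => //; apply: derivable_powR.
    by rewrite in_itv/= andbT (lt_trans a0).
  + by apply: cvg_at_right_filter; exact: cF.
  + by apply: cvg_at_left_filter; exact: cF.
- move=> x; rewrite in_itv/= => /andP[ax _].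
  have x0 : 0 < x by exact: lt_trans ax.
  rewrite derive1Ml; last by apply: derivable_powR; rewrite in_itv/= x0.
  rewrite powR_derive1 ?in_itv/= ?x0//.
  by rewrite mulrA mulVf ?mul1r// gt_eqF.
Qed.

(** The integrand may be unbounded at [0]: the fundamental theorem of calculus
applies on [[a, 1]] with [a > 0], and monotone convergence lets [a] tend to [0]. *)
Lemma integral_powR_unit_le (p : R) : 0 < p ->
  (\int[mu]_(t in `]0%R, 1%R]) (t `^ (p - 1))%:E <= (p^-1)%:E)%E.
Proof.
move=> p0.
pose F n := `[(n.+2%:R^-1 : R), 1]%classic.
have -> : `]0, 1]%classic = \bigcup_n F n.
  apply/seteqP; split => x /=.
    rewrite in_itv/= => /andP[x0 x1]; exists (Num.truncn x^-1) => //=.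
    rewrite /F /= in_itv/= x1 andbT invf_ple ?posrE//.
    apply: (le_trans (ltW (truncnS_gt _))).
    by rewrite ler_nat.
  move=> [n _]; rewrite /F/= !in_itv/= => /andP[h ->]; rewrite andbT.
  by apply: lt_le_trans h; rewrite invr_gt0.
have H : (\int[mu]_(t in F i) (t `^ (p - 1))%:E @[i --> \oo] -->
    \int[mu]_(t in \bigcup_i F i) (t `^ (p - 1))%:E)%E.
  apply: ge0_nondecreasing_set_cvg_integral.
  - move=> m n mn; apply/subsetPset => x; rewrite /F /= !in_itv/= => /andP[h ->].
    by rewrite andbT (le_trans _ h)// lef_pV2 ?posrE// ler_nat !ltnS.
  - by move=> i; exact: measurable_itv.
  - move=> i; apply/measurable_EFinP; apply: measurable_funTS.
    exact: measurable_powR.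
  - by move=> i x _; rewrite lee_fin powR_ge0.
rewrite -(cvg_lim _ H)//; apply: lime_le; first by apply/cvg_ex; eexists; exact: H.
apply: nearW => n; rewrite integral_powR_segment//; last first.
  by rewrite invr_gt0 ltr0n/= invf_lt1// ltr1n.
by rewrite lee_fin ler_piMl ?invr_ge0 ?ltW// gerBl powR_ge0.
Qed.

End powR_aux.

Section gamma.
Context {R : realType}.
Local Notation mu := (@lebesgue_measure R).

Implicit Types p t : R.

(** The truncated power [t_+ ^ p].  A convolution of truncated powers over the
whole line is one over [[0, t]], so that translations and Fubini's theorem
apply without tracking the domain. *)
Definition tpow (p t : R) : R := if 0 < t then t `^ p else 0.

Lemma tpow_ge0 p t : 0 <= tpow p t.
Proof. by rewrite /tpow; case: ifP => // _; exact: powR_ge0. Qed.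

Lemma measurable_tpow p : measurable_fun setT (tpow p).
Proof.
apply: measurable_fun_ifT => //.
exact: measurable_fun_ltr.
Qed.

(** Euler's integral as an extended real, before its convergence is known. *)
Definition gamma_int (p : R) : \bar R :=
  (\int[mu]_t (tpow (p - 1) t * expR (- t))%:E)%E.

Lemma measurable_gamma_int p : measurable_fun setT
  (fun t => (tpow (p - 1) t * expR (- t))%:E).
Proof.
apply/measurable_EFinP; apply: measurable_funM; first exact: measurable_tpow.
by apply: measurableT_comp; [exact: measurable_expR|].
Qed.

Lemma measurable_powR_expRN p :
  measurable_fun setT (fun t => (t `^ (p - 1) * expR (- t))%:E).
Proof.
apply/measurable_EFinP; apply: measurable_funM; first exact: measurable_powR.
by apply: measurableT_comp; [exact: measurable_expR|].
Qed.

Lemma gamma_int_itv p : gamma_int p =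
  (\int[mu]_(t in `]0%R, +oo[) (t `^ (p - 1) * expR (- t))%:E)%E.
Proof.
rewrite [RHS]integral_mkcond; apply: eq_integral => t _.
rewrite patchE /tpow; case: ifPn => [t0|t0].
  by rewrite mem_set//= in_itv/= t0.
by rewrite memNset/= ?mul0r// in_itv/= andbT; exact/negP.
Qed.

(** Near [0] the integrand is at most [t ^ (p - 1)]; beyond [1] it is at most a
multiple of the exponential density of rate [1 / 2]. *)
Lemma gamma_int_fin p : 0 < p -> (gamma_int p < +oo)%E.
Proof.
move=> p0; rewrite gamma_int_itv.
have mf := measurable_powR_expRN p.
have f0 (t : R) : (0 <= (t `^ (p - 1) * expR (- t))%:E)%E.
  by rewrite lee_fin mulr_ge0 ?powR_ge0 ?expR_ge0.
have -> : `]0, +oo[%classic = `]0, 1]%classic `|` `]1, +oo[%classic :> set R.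
  by rewrite -itv_bndbnd_setU// bnd_simp.
rewrite ge0_integral_setU//=; first last.
- rewrite disj_set2E; apply/eqP/seteqP; split => // x /= [].
  rewrite !in_itv/= => /andP[_ h1] /andP[h2 _].
  by move: (lt_le_trans h2 h1); rewrite ltxx.
- by apply: measurable_funTS.
apply: lte_add_pinfty.
  apply: le_lt_trans (ltry p^-1); apply: le_trans (integral_powR_unit_le p0).
  apply: ge0_le_integral => //.
  - by apply: measurable_funTS.
  - by apply/measurable_EFinP; apply: measurable_funTS; exact: measurable_powR.
  - move=> t; rewrite /= in_itv/= => /andP[t0 _].
    by rewrite lee_fin ler_piMr ?powR_ge0// -expR0 ler_expR oppr_le0 ltW.
(* [powR_le_expR] wants a positive exponent, while [p - 1] may be negative. *)
set C : R := (2 * (`|p - 1| + 1)) `^ (`|p - 1| + 1) * 2.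
have C0 : 0 <= C by rewrite mulr_ge0 ?powR_ge0.
have mpdf : measurable_fun setT (fun t : R => (exponential_pdf 2^-1 t)%:E).
  by apply/measurable_EFinP; apply: measurable_exponential_pdf.
have pdf0 (t : R) : (0 <= (exponential_pdf 2^-1 t)%:E)%E.
  by rewrite lee_fin exponential_pdf_ge0.
apply: (@le_lt_trans _ _ (\int[mu]_(t in `]1%R, +oo[)
    (C%:E * (exponential_pdf 2^-1 t)%:E))%E).
  apply: ge0_le_integral => //.
  - by apply: measurable_funTS.
  - by apply: measurable_funTS; apply: measurable_funeM.
  - move=> t; rewrite /= in_itv/= andbT => t1.
    have t0 : 0 < t by exact: lt_trans t1.
    rewrite -EFinM lee_fin exponential_pdfE ?(ltW t0)//.
    rewrite /C -!mulrA (mulrA 2) mulfV// mul1r.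
    have -> : expR (- t) = (expR (t / 2))^-1 * expR (- 2^-1 * t).
      by rewrite -expRN -expRD; congr expR; field.
    rewrite mulrA ler_wpM2r ?expR_ge0// ler_pdivrMr ?expR_gt0//.
    apply: le_trans (powR_le_expR _ t0); last by rewrite ltr_wpDl.
    rewrite ler_powR//; first exact: ltW.
    by rewrite (le_trans (ler_norm _))// lerDl.
rewrite ge0_integralZl//; last exact: measurable_funTS.
rewrite lte_mul_pinfty//; apply: (@le_lt_trans _ _ 1%E); last exact: ltry.
rewrite -(@integral_exponential_pdf _ (2^-1 : R))//.
by apply: ge0_subset_integral.
Qed.

Lemma gamma_intE p : 0 < p -> gamma_int p = (Gamma p)%:E.
Proof.
move=> p0; have := gamma_int_fin p0; rewrite gamma_int_itv => h.
rewrite /Gamma /Rintegral fineK// fin_numE -ltey h andbT -ltNye.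
apply: lt_le_trans (ltNyr 0) _; apply: integral_ge0 => t _.
by rewrite lee_fin mulr_ge0 ?powR_ge0 ?expR_ge0.
Qed.

(** Only the part of Euler's integral over [[a, a + 1]] is kept. *)
Lemma Gamma_ge (a c p : R) : 0 <= a -> 0 <= c -> 0 < p ->
  (forall t, a < t <= a + 1 -> c <= t `^ (p - 1)) ->
  c * expR (- (a + 1)) <= Gamma p.
Proof.
move=> a0 c0 p0 cle; rewrite -lee_fin -gamma_intE// gamma_int_itv.
have -> : ((c * expR (- (a + 1)))%:E =
    \int[mu]_(t in `]a, (a + 1)%R]) (cst (c * expR (- (a + 1)))%:E) t)%E.
  rewrite integral_cst//= lebesgue_measure_itv/= lte_fin ltrDl ltr01.
  by rewrite -EFinD -EFinM addrAC subrr add0r mulr1.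
have mf (D : set R) : measurable_fun D (fun t => (t `^ (p - 1) * expR (- t))%:E).
  by apply: measurable_funTS; exact: measurable_powR_expRN.
apply: (@le_trans _ _ (\int[mu]_(t in `]a, (a + 1)%R])
    (t `^ (p - 1) * expR (- t))%:E)%E).
  apply: ge0_le_integral => //.
  - by move=> t _; rewrite lee_fin mulr_ge0 ?expR_ge0.
  - exact: mf.
  - move=> t; rewrite /= in_itv/= => at1.
    rewrite lee_fin ler_pM ?expR_ge0 ?cle//.
    by rewrite ler_expR lerN2; case/andP: at1.
apply: ge0_subset_integral => //.
- exact: mf.
- by move=> t _; rewrite lee_fin mulr_ge0 ?powR_ge0 ?expR_ge0.
- by move=> t /=; rewrite !in_itv/= andbT => /andP[h _]; exact: le_lt_trans h.
Qed.

(** [Gamma] eventually dominates every geometric sequence, since [A] is arbitrary: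
this makes the Mittag-Leffler series entire. *)
Lemma Gamma_lower (A p : R) : 1 <= A -> 0 < p ->
  A `^ (p - 1) * expR (- (A + 1)) <= Gamma p.
Proof.
move=> A1 p0; have A0 := lt_le_trans ltr01 A1.
have [p1|p1] := leP 1 p.
  apply: Gamma_ge; rewrite ?powR_ge0 ?(ltW A0)// => t /andP[At _].
  have t0 := lt_trans A0 At.
  by rewrite ge0_ler_powR ?subr_ge0 ?nnegrE ?(ltW A0) ?(ltW t0) ?(ltW At).
have p10 : p - 1 <= 0 by rewrite subr_le0 ltW.
apply: (@le_trans _ _ (1 * expR (- (0 + 1)))); last first.
  apply: Gamma_ge => // t; rewrite add0r => /andP[t0 t1].
  by rewrite -[leLHS](powRr0 t) ger_powR ?t0.
rewrite ler_pM ?powR_ge0 ?expR_ge0//.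
  by rewrite -[leRHS](powRr0 A) ler_powR.
by rewrite ler_expR lerN2 lerD2r (ltW A0).
Qed.

Lemma Gamma_gt0 p : 0 < p -> 0 < Gamma p.
Proof.
move=> p0; apply: lt_le_trans (Gamma_lower (lexx 1) p0).
by rewrite mulr_gt0 ?powR_gt0 ?expR_gt0.
Qed.

End gamma.

(** * Euler's Beta integral *)

Section beta.
Context {R : realType}.
Local Notation mu := (@lebesgue_measure R).
Implicit Types a b p r s t : R.

Definition convol a b r : \bar R :=
  (\int[mu]_s (tpow (a - 1) (r - s) * tpow (b - 1) s)%:E)%E.

Lemma tpowM p r s : 0 < r -> tpow p (r * s) = r `^ p * tpow p s.
Proof.
move=> r0; rewrite /tpow pmulr_rgt0//; case: ifPn => s0; last by rewrite mulr0.
by rewrite powRM ?(ltW r0) ?(ltW s0).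
Qed.

Lemma convol_ge0 a b r : (0 <= convol a b r)%E.
Proof. by apply: integral_ge0 => s _; rewrite lee_fin mulr_ge0 ?tpow_ge0. Qed.

Lemma measurable_convol_fun a b r : measurable_fun setT
  (fun s => (tpow (a - 1) (r - s) * tpow (b - 1) s)%:E).
Proof.
apply/measurable_EFinP; apply: measurable_funM; last exact: measurable_tpow.
by apply: measurableT_comp; [exact: measurable_tpow|exact: measurable_funB].
Qed.

(** Substitute [s = r s']. *)
Lemma convol_scale a b r : 0 < r ->
  convol a b r = ((r `^ (a + b - 1))%:E * convol a b 1)%E.
Proof.
move=> r0; rewrite /convol (ge0_integral_affine 0 r0); last 2 first.
- exact: measurable_convol_fun.
- by move=> s; rewrite lee_fin mulr_ge0 ?tpow_ge0.
under eq_integral => s _.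
  rewrite addr0 (_ : r - r * s = r * (1 - s)); last by ring.
  rewrite !tpowM// (_ : _ * _ * _ = r `^ (a - 1) * r `^ (b - 1) *
    (tpow (a - 1) (1 - s) * tpow (b - 1) s)); last by ring.
  rewrite EFinM; over.
rewrite ge0_integralZl//; last 3 first.
- exact: measurable_convol_fun.
- by move=> s _; rewrite lee_fin mulr_ge0 ?tpow_ge0.
- by rewrite lee_fin mulr_ge0 ?powR_ge0.
rewrite muleA -EFinM; congr (_%:E * _)%E.
rewrite -[X in X * _](powRr1 (ltW r0)) -!powRD; last 2 first.
- by rewrite (gt_eqF r0) implybT.
- by rewrite (gt_eqF r0) implybT.
by congr powR; ring.
Qed.

Lemma convol_le0 a b r : r <= 0 -> convol a b r = 0%E.
Proof.
move=> r0; rewrite /convol integral0_eq// => s _.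
rewrite /tpow subr_gt0; case: ifPn => [sr|]; last by rewrite mul0r.
by rewrite ifF ?mulr0//; apply/negbTE; rewrite -leNgt (le_trans _ r0)// ltW.
Qed.

(** Write the product of the two Euler integrals as a double integral, translate
one variable by the other and exchange the integrations: the exponentials
combine to [exp (- r)], which multiplies the convolution at [r]. *)
Lemma gamma_int_mul a b : 0 < a -> 0 < b ->
  (gamma_int a * gamma_int b = gamma_int (a + b) * convol a b 1)%E.
Proof.
move=> a0 b0.
pose g p t := tpow (p - 1) t * expR (- t).
have mg p : measurable_fun setT (g p).
  by apply/measurable_EFinP; exact: measurable_gamma_int.
have g0 p t : 0 <= g p t by rewrite mulr_ge0 ?tpow_ge0 ?expR_ge0.
have ge0 p : (0 <= gamma_int p)%E.
  by apply: integral_ge0 => t _; rewrite lee_fin g0.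
pose f (z : measurableTypeR R * measurableTypeR R) : \bar R :=
  (g b z.1 * g a (z.2 - z.1))%:E.
have mf : measurable_fun setT f.
  apply/measurable_EFinP; apply: measurable_funM.
    exact: measurableT_comp (mg b) measurable_fst.
  apply: measurableT_comp; first exact: mg.
  by apply: measurable_funB; [exact: measurable_snd|exact: measurable_fst].
have f0 z : (0 <= f z)%E by rewrite lee_fin mulr_ge0.
transitivity (\int[mu]_s \int[mu]_r f (s, r))%E.
  rewrite muleC [X in (_ = X)%E](_ : _ =
      \int[mu]_s ((g b s)%:E * gamma_int a))%E; last first.
    apply: eq_integral => s _.
    rewrite /f/=; under eq_integral do rewrite EFinM.
    rewrite ge0_integralZl//; last 3 first.
    - apply/measurable_EFinP; apply: measurableT_comp; first exact: mg.
      exact: measurable_funB.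
    - by move=> t _; rewrite lee_fin.
    - by rewrite lee_fin.
    congr (_ * _)%E.
    rewrite /gamma_int (@ge0_integral_affine _ 1 (- s) (fun t => (g a t)%:E) ltr01).
    + by rewrite mul1e; under [in RHS]eq_integral do rewrite mul1r.
    + exact: measurable_gamma_int.
    + by move=> t; rewrite lee_fin.
  rewrite ge0_integralZr//.
  - exact: measurable_gamma_int.
  - by move=> t _; rewrite lee_fin.
rewrite fubini_tonelli//.
transitivity (\int[mu]_r ((g (a + b) r)%:E * convol a b 1))%E; last first.
  rewrite ge0_integralZr//.
  - exact: measurable_gamma_int.
  - by move=> t _; rewrite lee_fin.
  - exact: convol_ge0.
apply: eq_integral => r _.
transitivity ((expR (- r))%:E * convol a b r)%E.
  rewrite /convol -ge0_integralZl//; last 2 first.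
  - exact: measurable_convol_fun.
  - by move=> s _; rewrite lee_fin mulr_ge0 ?tpow_ge0.
  apply: eq_integral => s _; rewrite /f/= /g -EFinM; congr EFin.
  by rewrite (_ : - r = - s + - (r - s)) ?expRD; ring.
rewrite /g /tpow; case: ifPn => r0.
  by rewrite (convol_scale _ _ r0) muleA -EFinM mulrC.
by rewrite convol_le0 ?leNgt// mul0r mule0 mul0e.
Qed.

(** Euler's Beta integral, scaled from [[0, 1]] to [[0, t]]. *)
Lemma beta_integral a b t : 0 < a -> 0 < b -> 0 < t ->
  (\int[mu]_(s in `]0%R, t[) ((t - s) `^ (a - 1) * s `^ (b - 1))%:E =
   (t `^ (a + b - 1) * (Gamma a * Gamma b / Gamma (a + b)))%:E)%E.
Proof.
move=> a0 b0 t0; have ab0 : 0 < a + b by exact: addr_gt0.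
transitivity (convol a b t).
  rewrite integral_mkcond; apply: eq_integral => s _.
  rewrite patchE /tpow subr_gt0; case: ifPn => [|h].
    by rewrite inE/= in_itv/= => /andP[-> ->].
  case: ifPn => [st|]; last by rewrite mul0r.
  case: ifPn => [s0|]; last by rewrite mulr0.
  by move: h; rewrite notin_setE/= in_itv/= s0 st.
rewrite convol_scale// EFinM; congr (_ * _)%E.
have := gamma_int_mul a0 b0; rewrite !gamma_intE// -EFinM.
have G0 := Gamma_gt0 ab0.
have := convol_ge0 a b 1.
case: (convol a b 1) => [c _ [h]||].
- by congr EFin; rewrite h; field; rewrite gt_eqF.
- by move=> _; rewrite gt0_muley ?lte_fin.
- by rewrite leeNy_eq.
Qed.

End beta.

(** * Entire power series and the Mittag-Leffler function *)

Section entire.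
Context {R : realType}.
Implicit Types (c : R^nat) (x r : R).

(** The coefficients of an entire power series.  Requiring geometric decay at every
ratio makes the stability under formal derivation immediate, and the
convergence of the series follows from it. *)
Definition entire_coef c := forall r, 0 < r ->
  exists2 C, 0 <= C & forall k, `|c k| <= C * r ^+ k.

Lemma entire_coef_term c (X : R) : entire_coef c -> 0 <= X ->
  exists2 C, 0 <= C &
    forall x k, `|x| <= X -> `|c k * x ^+ k| <= C * 2^-1 ^+ k.
Proof.
move=> ec X0.
have d0 : 0 < 2 * (X + 1) by rewrite mulr_gt0// ltr_wpDl.
have [C C0 cC] := ec (2 * (X + 1))^-1 (ltac:(by rewrite invr_gt0)).
exists C => // x k xX; rewrite normrM normrX.
apply: (le_trans (ler_wpM2r _ (cC k))); first by rewrite exprn_ge0.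
rewrite -mulrA -exprMn ler_wpM2l// lerXn2r ?nnegrE ?mulr_ge0 ?invr_ge0 ?(ltW d0)//.
rewrite mulrC ler_pdivrMr// mulrA mulVf// mul1r (le_trans xX)// lerDl.
exact: ler01.
Qed.

(** The partial sums are bounded uniformly on a disc: the domination needed to
integrate the series term by term. *)
Lemma entire_coef_bounded c (X : R) : entire_coef c -> 0 <= X ->
  exists2 M, 0 <= M & forall n x, `|x| <= X -> `|pseries c x n| <= M.
Proof.
move=> ec X0; have [C C0 cC] := entire_coef_term ec X0.
exists (C * 2); first exact: mulr_ge0.
move=> n x xX; apply: (@le_trans _ _ (C * 2 * (1 - 2^-1 ^+ n))); last first.
  by rewrite ler_piMr ?mulr_ge0// gerBl exprn_ge0.
elim: n => [|n IH].
  by rewrite /pseries /series/= big_geq// normr0 expr0 subrr mulr0.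
rewrite /pseries seriesSr/= (le_trans (ler_normD _ _))//.
rewrite (le_trans (lerD IH (cC x n xX)))// exprS.
by rewrite le_eqVlt; apply/orP; left; apply/eqP; field.
Qed.

Lemma entire_coef_cvg c x : entire_coef c -> cvgn (pseries c x).
Proof.
move=> ec; have [C C0 cC] := entire_coef_term ec (normr_ge0 x).
apply: normed_cvg.
apply: (@series_le_cvg _ _ (fun n => C * 2^-1 ^+ n)) => [n|n|n|].
- exact: normr_ge0.
- by rewrite mulr_ge0// exprn_ge0.
- exact: cC.
- by apply: is_cvg_geometric_series; rewrite gtr0_norm// invf_lt1// ltr1n.
Qed.

(** The factor [k + 1] brought by the derivative is at most [2 ^ k], which the decay
at ratio [r / 2] absorbs. *)
Lemma entire_coef_diffs c : entire_coef c -> entire_coef (pseries_diffs c).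
Proof.
move=> ec r r0; have [C C0 cC] := ec (r / 2) (divr_gt0 r0 (ltr0Sn _ _)).
exists (C * r) => [|k]; first by rewrite mulr_ge0// ltW.
rewrite /pseries_diffs normrM normr_nat.
apply: (@le_trans _ _ (2 ^+ k.+1 * (C * (r / 2) ^+ k.+1))).
  by apply: ler_pM => //; rewrite -natrX ler_nat ltnW// ltn_expl.
rewrite mulrCA -exprMn mulrCA mulfV// mulr1 exprS mulrA.
exact: lexx.
Qed.

Lemma entire_coef_continuous c : entire_coef c ->
  continuous (fun x => limn (pseries c x)).
Proof.
move=> ec x; apply: differentiable_continuous; apply/derivable1_diffP.
apply: ex_derive; apply: (@pseries_snd_diffs _ c (`|x| + 1)).
- exact: entire_coef_cvg.
- by apply: entire_coef_cvg; exact: entire_coef_diffs.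
- by apply: entire_coef_cvg; do 2 apply: entire_coef_diffs.
- by rewrite (@ger0_norm _ (`|x| + 1)) ?ltrDl// addr_ge0.
Qed.

End entire.

Section mittag_leffler_series.
Context {R : realType}.
Variables alpha beta : R.
Hypotheses (alpha0 : 0 < alpha) (beta0 : 0 < beta).

Definition ml_coef k : R := (Gamma (k%:R * alpha + beta))^-1.

Lemma ml_arg_gt0 k : 0 < k%:R * alpha + beta.
Proof. by rewrite ltr_wpDl// mulr_ge0// ltW. Qed.

Lemma mittag_lefflerE z :
  mittag_leffler alpha beta z = limn (pseries ml_coef z).
Proof.
by rewrite /mittag_leffler /pseries; under eq_fun do rewrite mulrC.
Qed.

(** Apply [Gamma_lower] with [A ^ (- alpha) = r], after lowering [r] so that
[1 <= A]. *)
Lemma ml_coef_entire : entire_coef ml_coef.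
Proof.
move=> r r0; pose q := Num.min r 1.
have q0 : 0 < q by rewrite lt_min r0 ltr01.
have q1 : q <= 1 by rewrite ge_min lexx orbT.
have qr : q <= r by rewrite ge_min lexx.
pose A := q `^ (- alpha^-1).
have A1 : 1 <= A by rewrite -[leLHS](powRr0 q) ger_powR ?q0// oppr_le0 invr_ge0 ltW.
have A0 := lt_le_trans ltr01 A1.
exists (expR (A + 1) * A `^ (1 - beta)) => [|k].
  by rewrite mulr_ge0 ?expR_ge0 ?powR_ge0.
have G0 := Gamma_gt0 (ml_arg_gt0 k).
rewrite ger0_norm ?invr_ge0 ?(ltW G0)//.
apply: (@le_trans _ _ (expR (A + 1) * A `^ (1 - beta) * q ^+ k)); last first.
  rewrite ler_wpM2l ?mulr_ge0 ?expR_ge0 ?powR_ge0//.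
  by rewrite lerXn2r ?nnegrE ?(ltW r0) ?(ltW q0).
have -> : expR (A + 1) * A `^ (1 - beta) * q ^+ k =
    (A `^ (k%:R * alpha + beta - 1) * expR (- (A + 1)))^-1.
  rewrite invfM expRN invrK -powRN [RHS]mulrC -mulrA; congr (_ * _).
  have -> : - (k%:R * alpha + beta - 1) = - (k%:R * alpha) + (1 - beta) by ring.
  rewrite [RHS]powRD ?(gt_eqF A0) ?implybT// [LHS]mulrC; congr (_ * _).
  rewrite /A -powRrM -powR_mulrn ?(ltW q0)//; congr powR.
  by field; rewrite gt_eqF.
rewrite lef_pV2 ?posrE ?mulr_gt0 ?powR_gt0 ?expR_gt0//.
exact: Gamma_lower (ml_arg_gt0 k).
Qed.

Lemma ml_continuous : continuous (mittag_leffler alpha beta).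
Proof.
move=> z; rewrite /continuous_at mittag_lefflerE.
have -> : mittag_leffler alpha beta = fun z => limn (pseries ml_coef z).
  by apply/funext => y; exact: mittag_lefflerE.
exact: (entire_coef_continuous ml_coef_entire).
Qed.

Lemma mittag_leffler0 : mittag_leffler alpha beta 0 = (Gamma beta)^-1.
Proof.
rewrite mittag_lefflerE; apply: cvg_lim => //.
rewrite -cvg_shiftS; apply: cvg_near_cst; apply: nearW => n.
rewrite /pseries /series/= big_nat_recl//= big1_seq ?addr0.
  by rewrite expr0 mulr1 /ml_coef mul0r add0r.
by move=> i _; rewrite expr0n mulr0.
Qed.

End mittag_leffler_series.

(** * The Volterra equation *)

Section volterra.
Context {R : realType}.
Local Notation mu := (@lebesgue_measure R).
Variables alpha L : R.
Hypotheses (alpha0 : 0 < alpha) (L0 : 0 < L).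

Local Notation E := (mittag_leffler alpha alpha).
Local Notation c := (ml_coef alpha alpha).

(** As a function of time, [s ^ (alpha - 1) * relax s] is the kernel of the
fractional relaxation equation of order [alpha] and rate [L]. *)
Definition relax (s : R) : R := E (- L * s `^ alpha).

Lemma relax_continuous (s : R) : 0 < s -> {for s, continuous relax}.
Proof.
move=> s0; apply: (@continuous_comp _ _ _ (fun s => - L * s `^ alpha) E).
  by apply: continuousM; [exact: cst_continuous|exact: continuous_powR].
exact: ml_continuous.
Qed.

Lemma relax_cvg0 : relax s @[s --> 0^'+] --> (Gamma alpha)^-1.
Proof.
rewrite -(mittag_leffler0 alpha alpha).
apply: (@cvg_comp _ _ _ (fun s => - L * s `^ alpha) E _ (nbhs (0 : R))).
  have : (fun s => - L * s `^ alpha) s @[s --> 0^'+] --> - L * 0.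
    by apply: cvgM; [exact: cvg_cst|exact: powR_cvg0].
  by rewrite mulr0.
exact: ml_continuous.
Qed.

Lemma measurable_relax : measurable_fun setT relax.
Proof.
apply: measurableT_comp.
  by apply: continuous_measurable_fun; exact: ml_continuous.
by apply: measurable_funM => //; exact: measurable_powR.
Qed.

Lemma measurable_kernel (p q t : R) :
  measurable_fun setT (fun s : R => (t - s) `^ p * s `^ q).
Proof.
by apply: measurable_funM; [exact: measurable_powR_subr|exact: measurable_powR].
Qed.

Lemma integrable_kernel (a b t : R) : 0 < a -> 0 < b -> 0 < t ->
  mu.-integrable `]0, t[ (fun s => ((t - s) `^ (a - 1) * s `^ (b - 1))%:E).
Proof.
move=> a0 b0 t0; apply/integrableP; split.
  by apply/measurable_EFinP; apply: measurable_funTS; exact: measurable_kernel.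
under eq_integral do rewrite /= ger0_norm ?mulr_ge0 ?powR_ge0//.
by rewrite beta_integral// ltry.
Qed.

(** The Beta integral turns the term of index [k] into the term of index [k + 1],
hence the sum [n.+1] and the missing constant term [1] on the right. *)
Lemma integral_kernel_pseries (t : R) n : 0 < t ->
  (\int[mu]_(s in `]0%R, t[) ((t - s) `^ (alpha - 1) * s `^ (alpha - 1) *
     pseries c (- L * s `^ alpha) n)%:E =
   (t `^ (alpha - 1) *
     (1 - Gamma alpha * pseries c (- L * t `^ alpha) n.+1) / L)%:E)%E.
Proof.
move=> t0.
pose b k : R := k%:R * alpha + alpha.
have b0 k : 0 < b k by exact: ml_arg_gt0.
have termE k s : 0 < s -> (t - s) `^ (alpha - 1) * s `^ (alpha - 1) *
      (c k * (- L * s `^ alpha) ^+ k) =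
    c k * (- L) ^+ k * ((t - s) `^ (alpha - 1) * s `^ (b k - 1)).
  move=> s0; rewrite exprMn -(powR_mulrn _ (powR_ge0 s alpha)) -powRrM.
  have -> : b k - 1 = (alpha - 1) + alpha * k%:R by rewrite /b; ring.
  by rewrite (@powRD _ s (alpha - 1)) ?(gt_eqF s0) ?implybT//; ring.
transitivity (\int[mu]_(s in `]0%R, t[) (\sum_(0 <= k < n)
    (c k * (- L) ^+ k)%:E * ((t - s) `^ (alpha - 1) * s `^ (b k - 1))%:E))%E.
  apply: eq_integral => s; rewrite inE/= in_itv/= => /andP[s0 _].
  rewrite /pseries /series/= mulr_sumr -sumEFin.
  by apply: eq_bigr => k _; rewrite termE// EFinM.
rewrite integral_sum//; last first.
  by move=> k; apply: integrableZl => //; exact: integrable_kernel.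
have G0 p : 0 < p -> Gamma p != 0 by move=> p0; rewrite gt_eqF// Gamma_gt0.
have L1 : L != 0 by rewrite gt_eqF.
have -> : (t `^ (alpha - 1) *
     (1 - Gamma alpha * pseries c (- L * t `^ alpha) n.+1) / L =
   \sum_(0 <= k < n) (Gamma alpha * t `^ (alpha - 1) / - L *
     (c k.+1 * (- L * t `^ alpha) ^+ k.+1))).
  rewrite /pseries /series/= big_nat_recl//= expr0 -mulr_sumr.
  rewrite /ml_coef mul0r add0r; field.
  by rewrite L1 G0.
rewrite -sumEFin; apply: eq_bigr => k _.
rewrite integralZl//; last exact: integrable_kernel.
rewrite beta_integral// -EFinM; congr EFin.
have -> : alpha + b k - 1 = (alpha - 1) + alpha * k.+1%:R.
  by rewrite /b -natr1; ring.
rewrite (@powRD _ t (alpha - 1)) ?(gt_eqF t0) ?implybT//.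
rewrite powRrM powR_mulrn ?powR_ge0//.
have -> : alpha + b k = b k.+1 by rewrite /b -natr1; ring.
rewrite /ml_coef -/(b k) -/(b k.+1) exprMn !exprS.
by field; rewrite L1 !G0.
Qed.

(** The limit of [integral_kernel_pseries] by dominated convergence.  Domination comes
from [entire_coef_bounded], since [L * s ^ alpha] stays below [L * t ^ alpha]. *)
Lemma volterra (t : R) : 0 < t ->
  mu.-integrable `]0, t[
    (fun s => ((t - s) `^ (alpha - 1) * s `^ (alpha - 1) * relax s)%:E) /\
  (\int[mu]_(s in `]0%R, t[)
     ((t - s) `^ (alpha - 1) * s `^ (alpha - 1) * relax s)%:E =
   (t `^ (alpha - 1) * (1 - Gamma alpha * relax t) / L)%:E)%E.
Proof.
move=> t0.
have ec := ml_coef_entire alpha0 alpha0.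
have relaxE s : pseries c (- L * s `^ alpha) @ \oo --> relax s.
  by rewrite /relax mittag_lefflerE; exact: entire_coef_cvg.
have X0 : 0 <= L * t `^ alpha by rewrite mulr_ge0 ?powR_ge0 ?ltW.
have [M M0 cM] := entire_coef_bounded ec X0.
pose f_ n s := ((t - s) `^ (alpha - 1) * s `^ (alpha - 1) *
     pseries c (- L * s `^ alpha) n)%:E.
have mf_ n : measurable_fun `]0, t[ (f_ n).
  apply/measurable_EFinP; apply: measurable_funTS.
  apply: measurable_funM; first exact: measurable_kernel.
  rewrite /pseries /series/=; apply: measurable_sum => k.
  apply: measurable_funM => //; apply: measurable_funX.
  by apply: measurable_funM => //; exact: measurable_powR.
have [||||||intf _ cvgf] := @dominated_convergence _ _ R mu `]0, t[ _ f_
  (fun s => ((t - s) `^ (alpha - 1) * s `^ (alpha - 1) * relax s)%:E)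
  (fun s => M%:E * ((t - s) `^ (alpha - 1) * s `^ (alpha - 1))%:E)%E.
- exact: measurable_itv.
- exact: mf_.
- apply/measurable_EFinP; apply: measurable_funTS.
  by apply: measurable_funM; [exact: measurable_kernel|exact: measurable_relax].
- apply: aeW => s _; apply: cvg_EFin; first by apply: nearW.
  by apply: cvgMr; exact: relaxE.
- by apply: integrableZl => //; exact: integrable_kernel.
- apply: aeW => s n; rewrite /= in_itv/= => /andP[s0 st].
  rewrite lee_fin normrM ger0_norm ?mulr_ge0 ?powR_ge0// mulrC.
  rewrite ler_wpM2r ?mulr_ge0 ?powR_ge0// cM// normrM normrN.
  rewrite !ger0_norm ?powR_ge0 ?(ltW L0)// ler_wpM2l ?(ltW L0)//.
  by rewrite ge0_ler_powR ?nnegrE ?(ltW alpha0) ?(ltW s0) ?(ltW t0) ?(ltW st).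
split=> //; rewrite -(cvg_lim _ cvgf)//.
rewrite /f_; under eq_fun do rewrite integral_kernel_pseries//.
apply: cvg_lim => //; apply: cvg_EFin; first exact: nearW.
apply: cvgM; last exact: cvg_cst.
apply: cvgMr; apply: cvgB; first exact: cvg_cst.
apply: cvgMr; rewrite (cvg_shiftS (pseries c (- L * t `^ alpha))).
exact: relaxE.
Qed.

End volterra.

(** * Positivity and integral bounds for the relaxation function *)

Section relaxation.
Context {R : realType}.
Local Notation mu := (@lebesgue_measure R).

Lemma measurable_volterra_integrand (alpha L t : R) : 0 < alpha -> measurable_fun setT
  (fun s : R => ((t - s) `^ (alpha - 1) * s `^ (alpha - 1) * relax alpha L s)%:E).
Proof.
move=> alpha0.
apply/measurable_EFinP; apply: measurable_funM; first exact: measurable_kernel.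
exact: measurable_relax.
Qed.

Lemma ge0_integral_itv_split (f : R -> \bar R) (r t : R) : 0 < r < t ->
  measurable_fun setT f -> (forall x, 0 < x < t -> (0 <= f x)%E) ->
  (\int[mu]_(x in `]0%R, t[) f x =
   \int[mu]_(x in `]0%R, r[) f x + \int[mu]_(x in `[r, t[) f x)%E.
Proof.
move=> /andP[r0 rt] mf f0.
have E : `]0, t[%classic = `]0, r[%classic `|` `[r, t[%classic :> set R.
  by rewrite -itv_bndbnd_setU// bnd_simp// ltW.
rewrite E ge0_integral_setU//.
- by apply: measurable_funTS.
- by move=> x; rewrite -E/= in_itv/=; exact: f0.
- rewrite disj_set2E; apply/eqP/seteqP; split => // x /= [].
  rewrite !in_itv/= => /andP[_ h1] /andP[h2 _].
  by move: (lt_le_trans h1 h2); rewrite ltxx.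
Qed.

(** The mass of the kernel near its singularity: translate [[r, t]] to [[0, t - r]]
and use the Beta integral with second exponent [0]. *)
Lemma integral_kernel_near (a r t : R) : 0 < a -> r < t ->
  (\int[mu]_(s in `[r, t[) ((t - s) `^ (a - 1))%:E =
   ((t - r) `^ a * (Gamma a * Gamma 1 / Gamma (a + 1)))%:E)%E.
Proof.
move=> a0 rt; have tr0 : 0 < t - r by rewrite subr_gt0.
have mk (u : R) := measurable_powR_subr (a - 1) u.
have := @beta_integral R a 1 (t - r) a0 ltr01 tr0.
rewrite addrK => <-.
under [RHS]eq_integral do rewrite subrr powRr0 mulr1.
rewrite [RHS]integral_itv_obnd_cbnd; last first.
  by apply/measurable_EFinP; apply: measurable_funTS.
rewrite [LHS]integral_mkcond [RHS]integral_mkcond.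
rewrite (@ge0_integral_affine R 1 r _ ltr01).
- rewrite mul1e; apply: eq_integral => s _; rewrite !patchE mul1r.
  rewrite (_ : (s + r \in `[r, t[%classic) = (s \in `[0, (t - r)%R[%classic)).
    by rewrite (_ : t - (s + r) = t - r - s)//; ring.
  apply/idP/idP; rewrite !inE/= !in_itv/= => /andP[h1 h2]; apply/andP; split; lra.
- apply/(measurable_restrictT _ _).1 => //.
  by apply/measurable_EFinP; apply: measurable_funTS.
- by move=> x; apply: erestrict_ge0 => y _; rewrite lee_fin powR_ge0.
Qed.

Variables alpha L : R.
Hypotheses (alpha0 : 0 < alpha) (alpha1 : alpha < 1) (L0 : 0 < L).
Local Notation v := (relax alpha L).

Let a10 : alpha - 1 <= 0. Proof. by rewrite subr_le0 ltW. Qed.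

Lemma half_le_quarter_absurd (x y z : R) :
  2^-1 * x <= y + z -> y <= 0 -> z <= 4^-1 * x -> 0 < x -> False.
Proof. lra. Qed.

(** The function is positive near [0], where it tends to [1 / Gamma alpha], so the
infimum of its nonpositivity set is positive; by continuity it belongs to it. *)
Lemma relax_first_zero (t1 : R) : 0 < t1 -> v t1 <= 0 ->
  exists t0 : R, [/\ 0 < t0, v t0 <= 0 & forall s : R, 0 < s < t0 -> 0 < v s].
Proof.
move=> t10 vt1.
pose S := [set t | 0 < t /\ v t <= 0].
have S1 : S t1 by [].
have G0 : 0 < (Gamma alpha)^-1 by rewrite invr_gt0 Gamma_gt0.
have [e /= e0 He] : nbhs_ball (0 : R) (fun s => 0 < s -> 0 < v s).
  by apply/nbhs_ballP; exact: (cvgr_gt _ (relax_cvg0 L alpha0) _ G0).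
have lbS : lbound S e.
  move=> t [t0 vt]; rewrite leNgt; apply/negP => te.
  have := He t; rewrite /ball/= sub0r normrN gtr0_norm// => /(_ te t0).
  by rewrite ltNge vt.
have iS : has_inf S by split; [exists t1|exists e].
have le_inf t : S t -> inf S <= t by move=> St; apply: ge_inf => //; exists e.
have i0 : 0 < inf S by apply: lt_le_trans e0 _; apply: lb_le_inf => //; exists t1.
exists (inf S); split; first exact: i0.
- rewrite leNgt; apply/negP => v0.
  have [d /= d0 Hd] : nbhs_ball (inf S) (fun s => 0 < v s).
    by apply/nbhs_ballP; exact: (cvgr_gt _ (relax_continuous alpha0 i0) _ v0).
  have [t St td] := inf_adherent d0 iS; have it := le_inf _ St.
  have := Hd t; rewrite /ball/= distrC ger0_norm ?subr_ge0// ltrBlDl => /(_ td).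
  by rewrite ltNge St.2.
- move=> s /andP[s0 si]; rewrite ltNge; apply/negP => vs.
  by have := le_inf s (conj s0 vs); rewrite leNgt si.
Qed.

(** Compare the Volterra equation at [t0] with the one at [t].  Before [t] the two
kernels have ratio at most [(t0 / t) ^ (alpha - 1)], by log-convexity; between
[t] and [t0] the solution is at most [M].  The terms [t ^ (alpha - 1) / L] and
[t0 ^ (alpha - 1) / L] then cancel, as the ratio of the kernels at [t0] and [t]
is the same number. *)
Lemma volterra_step (t t0 M : R) : 0 < t -> t < t0 ->
  (forall s : R, 0 < s < t0 -> 0 <= v s) ->
  (forall s : R, t <= s < t0 -> s `^ (alpha - 1) * v s <= M) ->
  (t0 / t) `^ (alpha - 1) * (t `^ (alpha - 1) * v t * (Gamma alpha / L)) <=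
  t0 `^ (alpha - 1) * v t0 * (Gamma alpha / L) +
  M * ((t0 - t) `^ alpha * (Gamma alpha * Gamma 1 / Gamma (alpha + 1))).
Proof.
move=> t_gt0 tt0 vge0 vM; have t00 := lt_trans t_gt0 tt0.
have rho0 : 0 <= (t0 / t) `^ (alpha - 1) by exact: powR_ge0.
have mk : measurable_fun setT (fun s : R => ((t0 - s) `^ (alpha - 1))%:E).
  by apply/measurable_EFinP; exact: measurable_powR_subr.
have M0 : 0 <= M.
  apply: le_trans (vM t _); last by rewrite lexx.
  by rewrite mulr_ge0 ?powR_ge0// vge0// t_gt0.
have k0 r s : 0 < s < t0 ->
    (0 <= ((r - s) `^ (alpha - 1) * s `^ (alpha - 1) * v s)%:E)%E.
  by move=> s0; rewrite lee_fin !mulr_ge0 ?powR_ge0 ?vge0.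
have rhoE : (t0 / t) `^ (alpha - 1) * t `^ (alpha - 1) = t0 `^ (alpha - 1).
  by rewrite -powRM ?divr_ge0 ?(ltW t00) ?(ltW t_gt0)// divfK// gt_eqF.
have real_of_ereal (I0 I : \bar R) (r p p0 u u0 g m : R) : r * p = p0 ->
    I0 = (p0 * (1 - g * u0) / L)%:E -> I = (p * (1 - g * u) / L)%:E ->
    (I0 <= r%:E * I + m%:E)%E -> r * (p * u * (g / L)) <= p0 * u0 * (g / L) + m.
  move=> <- -> ->; rewrite -EFinM -EFinD lee_fin -subr_ge0 => le_rm.
  rewrite -subr_ge0; move: le_rm; congr (0 <= _); field.
  by rewrite gt_eqF.
apply: (real_of_ereal _ _ _ _ _ _ _ _ _ rhoE (volterra alpha0 L0 t00).2
  (volterra alpha0 L0 t_gt0).2).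
rewrite (@ge0_integral_itv_split _ t t0); last 3 first.
- by rewrite t_gt0.
- exact: measurable_volterra_integrand.
- exact: k0.
apply: leeD.
  rewrite -ge0_integralZl//; last 2 first.
  - by apply: measurable_funTS; exact: measurable_volterra_integrand.
  - move=> s; rewrite /= in_itv/= => /andP[s0 st].
    by apply: k0; rewrite s0 (lt_trans st).
  apply: ge0_le_integral => //.
  - move=> s; rewrite /= in_itv/= => /andP[s0 st].
    by apply: k0; rewrite s0 (lt_trans st).
  - by apply: measurable_funTS; exact: measurable_volterra_integrand.
  - apply: measurable_funTS; apply: measurable_funeM.
    exact: measurable_volterra_integrand.
  - move=> s; rewrite /= in_itv/= => /andP[s0 st].
    have vs : 0 <= v s by rewrite vge0// s0 (lt_trans st).
    have ts0 : 0 < t - s by rewrite subr_gt0.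
    rewrite -EFinM lee_fin !mulrA ler_wpM2r// ler_wpM2r ?powR_ge0//.
    rewrite -powRM; [|by rewrite divr_ge0 ?ltW|exact: ltW].
    apply: le_powR_npos => //; first by rewrite mulr_gt0 ?divr_gt0.
    rewrite mulrAC ler_pdivrMr// mulrBr mulrBl lerD2l lerN2 [leLHS]mulrC.
    by rewrite ler_wpM2r// ltW.
apply: (@le_trans _ _ (\int[mu]_(s in `[t, t0[)
    (M%:E * ((t0 - s) `^ (alpha - 1))%:E))%E).
  apply: ge0_le_integral => //.
  - move=> s; rewrite /= in_itv/= => /andP[s0 st].
    by apply: k0; rewrite st (lt_le_trans t_gt0).
  - by apply: measurable_funTS; exact: measurable_volterra_integrand.
  - by apply: measurable_funTS; apply: measurable_funeM.
  - move=> s; rewrite /= in_itv/= => st.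
    by rewrite -EFinM lee_fin [leRHS]mulrC -mulrA ler_wpM2l ?powR_ge0 ?vM.
rewrite ge0_integralZl//; last 2 first.
- exact: measurable_funTS.
- by move=> s _; rewrite lee_fin powR_ge0.
by rewrite integral_kernel_near.
Qed.

(** At a first zero [t0], the comparison [volterra_step] with a point [t] where the
solution is maximal on a short interval before [t0] is contradictory. *)
Lemma relax_gt0 (t : R) : 0 < t -> 0 < v t.
Proof.
move=> t_gt0; rewrite ltNge; apply/negP => /(relax_first_zero t_gt0).
move=> {t t_gt0}[t0 [t00 vt0 vpos]].
have G0 : 0 < Gamma alpha by exact: Gamma_gt0.
have step := volterra_step.
set K := Gamma alpha * Gamma 1 / Gamma (alpha + 1) in step.
have K0 : 0 < K by rewrite divr_gt0 ?mulr_gt0 ?Gamma_gt0// addr_gt0.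
pose w (s : R) := s `^ (alpha - 1) * v s.
have [d [d0 dt0 dK]] : exists d : R,
    [/\ 0 < d, d <= t0 / 2 & d `^ alpha * K <= 4^-1 * (Gamma alpha / L)].
  (* The length [d] at which [d ^ alpha * K] is a quarter of [Gamma alpha / L],
     against the half that remains because [(t0 / t) ^ (alpha - 1) >= 1 / 2]. *)
  pose q := Gamma alpha / (4 * L * K).
  have q0 : 0 < q by apply: divr_gt0 => //; do 2 apply: mulr_gt0 => //.
  exists (Num.min (t0 / 2) (q `^ alpha^-1)); split.
  - by rewrite lt_min divr_gt0//= powR_gt0.
  - by rewrite ge_min lexx.
  - have -> : 4^-1 * (Gamma alpha / L) = q * K.
      by rewrite /q; field; rewrite !gt_eqF.
    rewrite ler_wpM2r ?(ltW K0)//.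
    have qE : (q `^ alpha^-1) `^ alpha = q.
      by rewrite -powRrM (mulVf (lt0r_neq0 alpha0)) powRr1 ?(ltW q0).
    rewrite -[leRHS]qE.
    rewrite ge0_ler_powR ?nnegrE ?powR_ge0 ?(ltW alpha0)//.
      by rewrite le_min powR_ge0 divr_ge0 ?(ltW t00).
    by rewrite ge_min lexx orbT.
clearbody K.
have td0 : 0 < t0 - d by lra.
have [t /[!in_itv]/= /andP[tl tr] wmax] : exists2 t : R, t \in `[t0 - d, t0] &
    forall s : R, s \in `[t0 - d, t0] -> w s <= w t.
  apply: EVT_max; first by lra.
  apply: continuous_in_subspaceT => x; rewrite inE/= in_itv/= => /andP[xl _].
  have x0 := lt_le_trans td0 xl.
  by apply: cvgM; [exact: continuous_powR|exact: relax_continuous].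
have wd : 0 < w (t0 - d).
  by rewrite mulr_gt0 ?powR_gt0// vpos// td0/= gtrBl.
have wt : 0 < w t.
  by apply: lt_le_trans wd _; apply: wmax; rewrite in_itv/= lexx/= gerBl ltW.
have t_gt0 : 0 < t by exact: lt_le_trans tl.
have tt0 : t < t0.
  rewrite lt_neqAle tr andbT; apply: contraTneq wt => ->.
  by rewrite -leNgt mulr_ge0_le0 ?powR_ge0.
have rho2 : 2^-1 <= (t0 / t) `^ (alpha - 1).
  apply: (@le_trans _ _ (2 `^ (alpha - 1))).
    rewrite -(@powR_inv1 R 2 (ler0n _ 2)) ler_powR ?ler1n//.
    by rewrite lerBrDl subrr ltW.
  apply: le_powR_npos => //; first exact: divr_gt0.
  rewrite ler_pdivrMr//.
  by clear -tl dt0; lra.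
have vge0 (s : R) : 0 < s < t0 -> 0 <= v s by move=> /vpos/ltW.
have wM (s : R) : t <= s < t0 -> w s <= w t.
  move=> /andP[ts st]; apply: wmax.
  by rewrite in_itv/= (le_trans tl ts) ltW.
have le_rho := step t t0 (w t) t_gt0 tt0 vge0 wM.
rewrite -/(w t) -/(w t0) in le_rho.
have wt0 : w t0 * (Gamma alpha / L) <= 0.
  by rewrite pmulr_lle0 ?divr_gt0// /w pmulr_rle0// powR_gt0.
have c0 : 0 < w t * (Gamma alpha / L) by rewrite mulr_gt0 ?divr_gt0.
have le_half : 2^-1 * (w t * (Gamma alpha / L)) <=
    (t0 / t) `^ (alpha - 1) * (w t * (Gamma alpha / L)).
  by rewrite ler_wpM2r// ltW.
have le_quarter : w t * ((t0 - t) `^ alpha * K) <= 4^-1 * (w t * (Gamma alpha / L)).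
  rewrite [leRHS]mulrCA ler_wpM2l ?(ltW wt)//; apply: le_trans dK.
  rewrite ler_wpM2r ?(ltW K0)// ge0_ler_powR ?nnegrE ?(ltW alpha0) ?(ltW d0)//.
    by rewrite subr_ge0.
  by rewrite lerBlDr -lerBlDl.
exact: half_le_quarter_absurd (le_trans le_half le_rho) wt0 le_quarter c0.
Qed.

(** The convolution in the Volterra equation is nonnegative. *)
Lemma relax_le (t : R) : 0 < t -> v t <= (Gamma alpha)^-1.
Proof.
move=> t0; have It := (volterra alpha0 L0 t0).2.
have : (0 <= (t `^ (alpha - 1) * (1 - Gamma alpha * v t) / L)%:E)%E.
  rewrite -It; apply: integral_ge0 => s; rewrite /= in_itv/= => /andP[s0 _].
  by rewrite lee_fin !mulr_ge0 ?powR_ge0// ltW// relax_gt0.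
rewrite lee_fin -mulrA pmulr_rge0 ?powR_gt0// pmulr_lge0 ?invr_gt0//.
rewrite subr_ge0 -[in X in X -> _](mulrC (v t)) -ler_pdivlMr ?Gamma_gt0//.
by rewrite div1r.
Qed.

(** In the Volterra equation at [t], replace the kernel by its smallest value
[t ^ (alpha - 1)]. *)
Lemma integral_relax_le (t : R) : 0 < t ->
  (\int[mu]_(s in `]0%R, t[) (s `^ (alpha - 1) * v s)%:E <= (L^-1)%:E)%E.
Proof.
move=> t0; have It := (volterra alpha0 L0 t0).2.
have p0 : 0 < t `^ (alpha - 1) by rewrite powR_gt0.
have mw : measurable_fun setT (fun s : R => (s `^ (alpha - 1) * v s)%:E).
  apply/measurable_EFinP; apply: measurable_funM; first exact: measurable_powR.
  exact: measurable_relax.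
have w0 s : `]0, t[%classic s -> (0 <= (s `^ (alpha - 1) * v s)%:E)%E.
  rewrite /= in_itv/= => /andP[s0 _].
  by rewrite lee_fin mulr_ge0 ?powR_ge0// ltW// relax_gt0.
rewrite -(@lee_pmul2l _ (t `^ (alpha - 1))%:E) ?lte_fin//.
apply: (@le_trans _ _ (t `^ (alpha - 1) * (1 - Gamma alpha * v t) / L)%:E).
  rewrite -It -ge0_integralZl//; last 2 first.
  - by apply: measurable_funTS; exact: mw.
  - by rewrite lee_fin ltW.
  apply: ge0_le_integral => //.
  - by move=> s s0; rewrite mule_ge0 ?w0// lee_fin (ltW p0).
  - by apply: measurable_funTS; apply: measurable_funeM; exact: mw.
  - by apply: measurable_funTS; exact: measurable_volterra_integrand.
  - move=> s /=; rewrite in_itv/= => /andP[s0 st].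
    rewrite -EFinM lee_fin -[leRHS]mulrA ler_wpM2r//.
      by rewrite mulr_ge0 ?powR_ge0// ltW// relax_gt0.
    by apply: le_powR_npos; rewrite ?subr_gt0// gerBl ltW.
rewrite -EFinM lee_fin ler_wpM2r ?invr_ge0 ?(ltW L0)// ler_piMr ?(ltW p0)//.
by rewrite gerBl mulr_ge0// ltW ?Gamma_gt0 ?relax_gt0.
Qed.

(** The two terms are the contributions before and after the cut in
[integral_relax_sq_le]; the quotient of [Gamma] values is [1 / (2 alpha - 1)]. *)
Definition relax_cst : R :=
  (Gamma alpha)^-1 * (Gamma 1 * Gamma (2 * alpha - 1) / Gamma (2 * alpha)) + 1.

(** Cut at [rho = L ^ (- 1 / alpha)], the time scale of the equation.  On
[[0, rho]] use [relax_le]; beyond, [s ^ (2 alpha - 2)] is at most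
[rho ^ (alpha - 1) * s ^ (alpha - 1)] and [integral_relax_le] applies. *)
Lemma integral_relax_sq_le (T : R) : 0 < T -> 2^-1 < alpha ->
  (\int[mu]_(s in `]0%R, T[) (s `^ (2 * alpha - 2) * v s)%:E <=
   (relax_cst * L `^ (-2 + alpha^-1))%:E)%E.
Proof.
move=> T0 alpha2; have a20 : 0 < 2 * alpha - 1 by lra.
have mw p : measurable_fun setT (fun s : R => (s `^ p * v s)%:E).
  apply/measurable_EFinP; apply: measurable_funM; first exact: measurable_powR.
  exact: measurable_relax.
have w0 p s : 0 < s -> (0 <= (s `^ p * v s)%:E)%E.
  by move=> s0; rewrite lee_fin mulr_ge0 ?powR_ge0// ltW// relax_gt0.
pose rho := L `^ (- alpha^-1).
have rho0 : 0 < rho by rewrite powR_gt0.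
have Tr : 0 < T + rho by rewrite addr_gt0.
(* The horizon is enlarged so that the cut lies inside the interval. *)
apply: (@le_trans _ _ (\int[mu]_(s in `]0%R, (T + rho)%R[)
    (s `^ (2 * alpha - 2) * v s)%:E)%E).
  apply: ge0_subset_integral => //.
  - by apply: measurable_funTS; exact: mw.
  - by move=> s; rewrite /= in_itv/= => /andP[s0 _]; exact: w0.
  - move=> s /=; rewrite !in_itv/= => /andP[-> sT]/=.
    by rewrite (lt_trans sT)// ltrDl.
rewrite (@ge0_integral_itv_split _ rho); last 3 first.
- by rewrite rho0 ltrDr.
- exact: mw.
- by move=> s /andP[s0 _]; exact: w0.
rewrite /relax_cst [X in (_ <= X%:E)%E]mulrDl EFinD mul1r; apply: leeD.
  apply: (@le_trans _ _ (\int[mu]_(s in `]0%R, rho[)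
      (((Gamma alpha)^-1)%:E * (s `^ (2 * alpha - 2))%:E))%E).
    apply: ge0_le_integral => //.
    - by move=> s; rewrite /= in_itv/= => /andP[s0 _]; exact: w0.
    - by apply: measurable_funTS; exact: mw.
    - apply: measurable_funTS; apply: measurable_funeM; apply/measurable_EFinP.
      exact: measurable_powR.
    - move=> s; rewrite /= in_itv/= => /andP[s0 _].
      by rewrite -EFinM lee_fin mulrC ler_wpM2r ?powR_ge0// relax_le.
  rewrite ge0_integralZl//; last 3 first.
  - apply: measurable_funTS; apply/measurable_EFinP; exact: measurable_powR.
  - by move=> s _; rewrite lee_fin powR_ge0.
  - by rewrite lee_fin invr_ge0 ltW// Gamma_gt0.
  have -> : (\int[mu]_(s in `]0%R, rho[) (s `^ (2 * alpha - 2))%:E =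
      \int[mu]_(s in `]0%R, rho[)
        ((rho - s) `^ (1 - 1) * s `^ (2 * alpha - 1 - 1))%:E)%E.
    apply: eq_integral => s _; rewrite subrr powRr0 mul1r.
    by congr (_ `^ _)%:E; ring.
  rewrite beta_integral// -EFinM lee_fin.
  have -> : 1 + (2 * alpha - 1) = 2 * alpha by ring.
  rewrite /rho -powRrM.
  have -> : - alpha^-1 * (2 * alpha - 1) = -2 + alpha^-1 by field; rewrite gt_eqF.
  by rewrite mulrCA mulrC.
apply: (@le_trans _ _ (\int[mu]_(s in `[rho, (T + rho)%R[)
      ((rho `^ (alpha - 1))%:E * (s `^ (alpha - 1) * v s)%:E))%E).
  apply: ge0_le_integral => //.
  - move=> s; rewrite /= in_itv/= => /andP[s0 _]; apply: w0.
    exact: lt_le_trans s0.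
  - by apply: measurable_funTS; exact: mw.
  - by apply: measurable_funTS; apply: measurable_funeM; exact: mw.
  - move=> s; rewrite /= in_itv/= => /andP[rs _].
    have s0 := lt_le_trans rho0 rs.
    rewrite -EFinM lee_fin mulrA ler_wpM2r ?(ltW (relax_gt0 s0))//.
    have -> : 2 * alpha - 2 = (alpha - 1) + (alpha - 1) by ring.
    rewrite powRD ?(gt_eqF s0) ?implybT// ler_wpM2r ?powR_ge0//.
    exact: le_powR_npos.
rewrite ge0_integralZl//; last 3 first.
- by apply: measurable_funTS; exact: mw.
- move=> s; rewrite /= in_itv/= => /andP[s0 _]; apply: w0.
  exact: lt_le_trans s0.
- by rewrite lee_fin powR_ge0.
apply: (@le_trans _ _ ((rho `^ (alpha - 1))%:E * (L^-1)%:E)%E).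
  rewrite lee_wpmul2l ?lee_fin ?powR_ge0//.
  apply: le_trans (integral_relax_le Tr); apply: ge0_subset_integral => //.
  - by apply: measurable_funTS; exact: mw.
  - by move=> s; rewrite /= in_itv/= => /andP[s0 _]; exact: w0.
  - by move=> s /=; rewrite !in_itv/= => /andP[s0 ->]; rewrite (lt_le_trans rho0).
rewrite -EFinM lee_fin /rho -powRrM -(powR_inv1 (ltW L0)).
rewrite -powRD ?(gt_eqF L0) ?implybT//.
rewrite le_eqVlt; apply/orP; left; apply/eqP; congr powR.
by field; rewrite gt_eqF.
Qed.

End relaxation.

(** * The two estimates *)

Section estimates.
Context {R : realType}.
Local Notation mu := (@lebesgue_measure R).

(** The reflection is a negation followed by a translation, and both preserve the
Lebesgue measure. *)
Lemma ae_reflect (T : R) (P : R -> Prop) :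
  {ae mu, forall t, P t} -> {ae mu, forall t, P (T - t)}.
Proof.
move=> [N [mN N0 PN]].
have mN' : measurable ((fun t : R => T - t) @^-1` N).
  have mr : measurable_fun setT (fun t : R => T - t) by exact: measurable_funB.
  by rewrite -[X in measurable X]setTI; exact: mr.
exists ((fun t => T - t) @^-1` N); split; first exact: mN'.
- rewrite -[RHS]N0 (lebesgue_measure_affine T ltr01 mN) mul1e.
  rewrite -(lebesgue_measureN mN') /pushforward.
  by congr (mu _); apply/seteqP; split => t /=; rewrite opprK mul1r addrC.
- by move=> t /= nP; apply: PN.
Qed.

Lemma measurable_reflect (T : R) (h : R -> R) : measurable_fun `]0, T[ h ->
  measurable_fun `]0, T[ (fun t => h (T - t)).
Proof.
move=> mh; apply: (measurable_comp _ _ mh); first exact: measurable_itv.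
  move=> _ /= [t + <-]; rewrite !in_itv/= => /andP[t0 tT].
  by apply/andP; split; lra.
exact: measurable_funB.
Qed.

Variables alpha T : R.
Hypotheses (alpha0 : 0 < alpha) (alpha1 : alpha < 1) (T0 : 0 < T).

Lemma convolution_relax_le (L M : R) (h : R -> R) : 0 < L -> 0 <= M ->
  measurable_fun `]0, T[ h ->
  {ae mu, forall t, t \in `]0, T[ -> `|h t| <= M} ->
  (`| \int[mu]_(tau in `]0%R, T[)
      (tau `^ (alpha - 1) * relax alpha L tau * h (T - tau))%:E |
   <= (M * L^-1)%:E)%E.
Proof.
move=> L0 M0 mh hM.
have mw : measurable_fun setT (fun s : R => s `^ (alpha - 1) * relax alpha L s).
  apply: measurable_funM; first exact: measurable_powR.
  exact: measurable_relax.
have w0 s : 0 < s -> 0 <= s `^ (alpha - 1) * relax alpha L s.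
  by move=> s0; rewrite mulr_ge0 ?powR_ge0// ltW// relax_gt0.
have mf : measurable_fun `]0, T[ (fun tau =>
    (tau `^ (alpha - 1) * relax alpha L tau * h (T - tau))%:E).
  apply/measurable_EFinP; apply: measurable_funM; last exact: measurable_reflect.
  by apply: measurable_funTS; exact: mw.
apply: le_trans (le_abse_integral mu (measurable_itv _) mf) _.
apply: (@le_trans _ _ (\int[mu]_(tau in `]0%R, T[)
    (M%:E * (tau `^ (alpha - 1) * relax alpha L tau)%:E))%E).
  apply: ae_ge0_le_integral => //.
  - by apply: measurableT_comp.
  - move=> s /=; rewrite in_itv/= => /andP[s0 _].
    by rewrite -EFinM lee_fin mulr_ge0 ?w0.
  - apply: measurable_funTS; apply: measurable_funeM.
    by apply/measurable_EFinP; exact: mw.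
  - have [N [mN muN sub]] := ae_reflect T hM; exists N; split=> // s /= ns.
    apply: sub => /= hs; apply: ns; rewrite in_itv/= => /andP[s0 sT].
    rewrite -EFinM lee_fin normrM ger0_norm ?w0// mulrC ler_wpM2r ?w0//.
    by apply: hs; rewrite in_itv/= subr_gt0 sT/= gtrBl.
rewrite ge0_integralZl//.
- by rewrite EFinM lee_wpmul2l ?lee_fin ?integral_relax_le.
- by apply: measurable_funTS; apply/measurable_EFinP; exact: mw.
- by move=> s /=; rewrite in_itv/= => /andP[s0 _]; rewrite lee_fin w0.
Qed.

Lemma integral_relax_mul_le (L0 L : R) : 2^-1 < alpha -> 0 < L0 -> 0 < L ->
  (`| \int[mu]_(tau in `]0%R, T[)
      (tau `^ (2 * alpha - 2) * relax alpha L0 tau * relax alpha L tau)%:E |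
   <= ((Gamma alpha)^-1 * relax_cst alpha * L `^ (-2 + alpha^-1))%:E)%E.
Proof.
move=> alpha2 L00 L_gt0.
have mp : measurable_fun setT (fun s : R => s `^ (2 * alpha - 2) * relax alpha L s).
  apply: measurable_funM; first exact: measurable_powR.
  exact: measurable_relax.
have mf : measurable_fun `]0, T[ (fun tau =>
    (tau `^ (2 * alpha - 2) * relax alpha L0 tau * relax alpha L tau)%:E).
  apply/measurable_EFinP; apply: measurable_funTS.
  apply: measurable_funM; last exact: measurable_relax.
  apply: measurable_funM; first exact: measurable_powR.
  exact: measurable_relax.
have p0 s : 0 < s -> 0 <= s `^ (2 * alpha - 2) * relax alpha L s.
  by move=> s0; rewrite mulr_ge0 ?powR_ge0// ltW// relax_gt0.
have G0 : 0 <= (Gamma alpha)^-1 by rewrite invr_ge0 ltW// Gamma_gt0.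
apply: le_trans (le_abse_integral mu (measurable_itv _) mf) _.
apply: (@le_trans _ _ (\int[mu]_(tau in `]0%R, T[)
    (((Gamma alpha)^-1)%:E * (tau `^ (2 * alpha - 2) * relax alpha L tau)%:E))%E).
  apply: ge0_le_integral => //.
  - by apply: measurableT_comp.
  - apply: measurable_funTS; apply: measurable_funeM.
    by apply/measurable_EFinP; exact: mp.
  - move=> s /=; rewrite in_itv/= => /andP[s0 sT].
    rewrite -EFinM lee_fin mulrAC normrM ger0_norm ?p0// mulrC ler_wpM2r ?p0//.
    by rewrite gtr0_norm ?relax_gt0// relax_le.
rewrite ge0_integralZl//.
- by rewrite -mulrA EFinM lee_wpmul2l ?lee_fin// integral_relax_sq_le.
- by apply: measurable_funTS; apply/measurable_EFinP; exact: mp.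
- by move=> s /=; rewrite in_itv/= => /andP[s0 _]; rewrite lee_fin p0.
Qed.

End estimates.

Theorem lemma4p4 (R : realType) (alpha T : R) (d : nat)
  (D : set 'rV[R]_d.+1)
  (a : 'I_d.+1 -> 'I_d.+1 -> 'rV[R]_d.+1 -> R)
  (b : 'I_d.+1 -> 'rV[R]_d.+1 -> R) (c : 'rV[R]_d.+1 -> R)
  (lam : nat -> R) (phi : nat -> 'rV[R]_d.+1 -> R)
  (h : R -> R) (c_h : R) (g : 'rV[R]_d.+1 -> R) (N0 : nat)
  (alpha_gt : 2^-1 < alpha) (alpha_lt : alpha < 1) (T_gt0 : 0 < T)
  (D_open : open D) (D_bounded : bounded_set D)
  (a_smooth : forall i j, smooth (a i j))
  (b_smooth : forall i, smooth (b i))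
  (c_smooth : smooth c)
  (A_symmetric : symmetric_op D a b c)
  (A_elliptic : elliptic D a)
  (A_posdef : positive_definite_op D a b c)
  (A_eigen : dirichlet_eigensystem D a b c lam phi)
  (h_Linfty : Linfty_interval T h)
  (c_h_gt0 : 0 < c_h)
  (h_ge : {ae lebesgue_measure, forall t, t \in `]0, T[ -> c_h <= h t})
  (g_L2 : L2 D g) (g_neq0 : ~ ae_eq_on D g (cst 0))
  (g_N0 : inner D g (phi N0) != 0) :
  exists C : R, forall n : nat,
    (`| \int[lebesgue_measure]_(tau in `]0%R, T[)
          (tau `^ (alpha - 1)
           * mittag_leffler alpha alpha (- lam n * tau `^ alpha)
           * h (T - tau))%:E |
      <= (C * (lam n)^-1)%:E)%E
    /\
    (`| \int[lebesgue_measure]_(tau in `]0%R, T[)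
          (tau `^ (2 * alpha - 2)
           * mittag_leffler alpha alpha (- lam N0 * tau `^ alpha)
           * mittag_leffler alpha alpha (- lam n * tau `^ alpha))%:E |
      <= (C * lam n `^ (-1 + (2 * alpha)^-1))%:E)%E.
Proof.
have alpha0 : 0 < alpha by apply: lt_trans alpha_gt; rewrite invr_gt0.
have [lam0 lam_homo _ _ _] := A_eigen.
have lam_gt0 n : 0 < lam n by apply: lt_le_trans lam0 _; exact: lam_homo.
have [mh [M hM]] := h_Linfty.
have hM' : {ae lebesgue_measure, forall t, t \in `]0, T[ -> `|h t| <= `|M|}.
  have [N [mN muN sub]] := hM; exists N; split=> // t /= nt.
  by apply: sub => /= ht; apply: nt => tT; apply: le_trans (ht tT) (ler_norm M).
(* [integral_relax_mul_le] gives the exponent [2 e]; one factor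
   [lam n ^ e] is bounded by [lam 0 ^ e] because [e <= 0]. *)
pose e := -1 + (2 * alpha)^-1.
have e0 : e <= 0.
  rewrite /e addrC subr_le0 invf_le1 ?mulr_gt0//.
  by rewrite -ler_pdivrMl// mulr1 ltW.
have G_ge0 p : 0 < p -> 0 <= Gamma p by move=> p0; rewrite ltW// Gamma_gt0.
have cst0 : 0 <= relax_cst alpha.
  by rewrite addr_ge0// mulr_ge0 ?divr_ge0 ?invr_ge0 ?mulr_ge0 ?G_ge0//; lra.
pose C2 := (Gamma alpha)^-1 * relax_cst alpha * lam 0%N `^ e.
have C20 : 0 <= C2.
  by rewrite !mulr_ge0 ?powR_ge0// invr_ge0 G_ge0.
exists (`|M| + C2) => n; split.
  apply: le_trans (convolution_relax_le alpha0 alpha_lt T_gt0 (lam_gt0 n)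
    (normr_ge0 M) mh hM') _.
  by rewrite lee_fin ler_wpM2r ?invr_ge0 ?(ltW (lam_gt0 n))// lerDl.
apply: le_trans (integral_relax_mul_le alpha0 alpha_lt T_gt0 alpha_gt
  (lam_gt0 N0) (lam_gt0 n)) _.
rewrite lee_fin -/e.
have -> : -2 + alpha^-1 = e + e by rewrite /e; field; rewrite gt_eqF.
rewrite powRD ?(gt_eqF (lam_gt0 n)) ?implybT// mulrA.
rewrite ler_wpM2r ?powR_ge0//.
apply: (@le_trans _ _ C2); last by rewrite lerDr.
rewrite /C2 ler_wpM2l//; last by apply: le_powR_npos => //; exact: lam_homo.
by rewrite mulr_ge0// invr_ge0 G_ge0.
Qed.
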